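(* Let $\ell>1$ be an odd integer. For all positive integers $n$, \[ b_{\ell}^e(n)-b_{\ell}^o(n)=(-1)^n c_{\ell}(n), \] where $b_{\ell}^e(n)$ (resp. $b_{\ell}^o(n)$) is the number of $\ell$-regular partitions of $n$ into an even (resp. odd) number of parts, and $c_{\ell}(n)$ is the number of partitions of $n$ into distinct odd parts none of which is divisible by $\ell$.
   Context: A partition of a positive integer $n$ is a finite nonincreasing sequence of positive integers summing to $n$; its entries are its parts. For an integer $\ell>1$, a partition is called $\ell$-regular if none of its parts is divisible by $\ell$. *)

(* Defs.v *)
From HB Require Import structures.
From mathcomp Require Import all_boot.

Set Implicit Arguments.
Unset Strict Implicit.
Unset Printing Implicit Defensive.

Definition is_part (n : nat) (s : seq nat) : bool :=
  [&& sorted geq s, all (ltn 0) s & sumn s == n].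

Record intpart (n : nat) : Type :=
  IntPart { parts :> seq nat; partsP : is_part n parts }.

HB.instance Definition _ n := [isSub for @parts n].
HB.instance Definition _ n := [Countable of intpart n by <:].

(* A partition of n has at most n parts, each at most n; embedding it into
   the bounded sequences over 'I_n.+1 gives the finType structure. *)
Lemma intpart_size n (p : intpart n) : size (map (@inord n) p) <= n.
Proof.
case: p => s /= /and3P[_ pos /eqP <-]; rewrite size_map.
elim: s pos {n} => //= x s IHs /andP[x_gt0 /IHs le_s].
by rewrite -add1n leq_add.
Qed.

Lemma intpart_le n (p : intpart n) x : x \in parts p -> x <= n.
Proof.
case: p => s /= /and3P[_ _ /eqP <-].
elim: s {n} => //= y s IHs; rewrite in_cons => /predU1P[->|/IHs le_x].
  exact: leq_addr.
exact: leq_trans le_x (leq_addl _ _).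
Qed.

Definition bseq_of_intpart n (p : intpart n) : {bseq n of 'I_n.+1} :=
  Bseq (intpart_size p).

Definition intpart_of_bseq n (t : {bseq n of 'I_n.+1}) : option (intpart n) :=
  insub (map val t).

Lemma bseq_of_intpartK n : pcancel (@bseq_of_intpart n) (@intpart_of_bseq n).
Proof.
move=> p; rewrite /intpart_of_bseq /= -map_comp -[RHS]valK /=.
congr insub; rewrite -[RHS]map_id; apply/eq_in_map => x /intpart_le le_x /=.
by rewrite inordK.
Qed.

HB.instance Definition _ n : isFinite (intpart n) :=
  PCanIsFinite (@bseq_of_intpartK n).

Definition regular (l : nat) (s : seq nat) : bool :=
  all (fun x => ~~ (l %| x)) s.

Definition b_even (l n : nat) : nat :=
  #|[set p : intpart n | regular l p & ~~ odd (size p)]|.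

Definition b_odd (l n : nat) : nat :=
  #|[set p : intpart n | regular l p & odd (size p)]|.

Definition c_odd_distinct (l n : nat) : nat :=
  #|[set p : intpart n | [&& uniq p, all odd p & regular l p]]|.

(* Main.v *)
Require Import Defs.
From mathcomp Require Import all_boot all_order all_algebra.
From mathcomp Require Import zify.

(** A sign-reversing involution.  Let [y] be the largest even number such that
    [y] is a part or [y/2] is a repeated part.  If [y] is a part, split it into
    two parts [y/2]; otherwise merge two parts [y/2] into [y].  By maximality
    [2y] is not eligible, so [y] occurs at most once, and [y] is still the
    largest eligible number after the move: repeating the move undoes it.
    The move changes the number of parts by one, and preserves [l]-regularity
    because [l] is odd.  No such [y] exists exactly when the parts are odd and
    distinct, and then the number of parts has the parity of [n]. *)

Set Implicit Arguments.
Unset Strict Implicit.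
Unset Printing Implicit Defensive.

(** * Eligible even numbers and the move on sequences *)

Definition pivot (s : seq nat) (y : nat) : bool :=
  ~~ odd y && ((y \in s) || (1 < count_mem y./2 s)).

Definition max_pivot (s : seq nat) (y : nat) : Prop :=
  pivot s y /\ forall z, pivot s z -> z <= y.

(** The result is left unsorted, so statements about it hold up to [perm_eq] until [flip] sorts
    it. *)
Definition toggle (y : nat) (s : seq nat) : seq nat :=
  if y \in s then [:: y./2, y./2 & rem y s]
  else y :: rem y./2 (rem y./2 s).

Definition odd_distinct (s : seq nat) : bool := uniq s && all odd s.

Lemma perm_pivot s t : perm_eq s t -> pivot s =1 pivot t.
Proof. by move=> st y; rewrite /pivot (perm_mem st) (permP st). Qed.

Lemma perm_rem2 (T : eqType) (x : T) s :
  1 < count_mem x s -> perm_eq s [:: x, x & rem x (rem x s)].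
Proof.
move=> x2; have xs : x \in s by rewrite -has_pred1 has_count ltnW.
apply: perm_trans (perm_to_rem xs) _; rewrite perm_cons.
by apply: perm_to_rem; rewrite -has_pred1 has_count count_rem xs /= eqxx subn_gt0.
Qed.

Lemma perm_rem (T : eqType) (x : T) s t : perm_eq s t -> perm_eq (rem x s) (rem x t).
Proof.
move=> st; have [xs|xs] := boolP (x \in s).
  rewrite -(perm_cons x) -(permPl (perm_to_rem xs)) (permPl st) perm_to_rem //.
  by rewrite -(perm_mem st).
by rewrite !rem_id // -(perm_mem st).
Qed.

Lemma perm_toggle y s t : perm_eq s t -> perm_eq (toggle y s) (toggle y t).
Proof.
move=> st; rewrite /toggle (perm_mem st); case: ifP => _.
  by rewrite !perm_cons perm_rem.
by rewrite perm_cons !perm_rem.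
Qed.

Lemma pivot_notin s y : pivot s y -> y \notin s -> 1 < count_mem y./2 s.
Proof. by case/andP=> _ /orP[->|]. Qed.

Lemma pivot_gt0 s y : all (ltn 0) s -> pivot s y -> 0 < y.
Proof.
move=> /allP pos /andP[_]; case: y => // /orP[/pos//|c].
by have /pos : 0 \in s by rewrite -has_pred1 has_count ltnW.
Qed.

(** Two copies of [y] would make [y.*2] a pivot, strictly larger since [y] is positive. *)
Lemma max_pivot_count s y : 0 < y -> max_pivot s y -> count_mem y s <= 1.
Proof.
move=> y0 [_ maxy]; rewrite leqNgt; apply/negP => c.
have /maxy : pivot s y.*2 by rewrite /pivot odd_double doubleK c orbT.
lia.
Qed.

Lemma half_even y : ~~ odd y -> y = y./2 + y./2.
Proof. by move=> ey; rewrite addnn even_halfK. Qed.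

(** Splitting removes the only copy of [y], so a second toggle takes the other branch. *)
Lemma mem_toggle s y :
  0 < y -> max_pivot s y -> (y \in toggle y s) = (y \notin s).
Proof.
move=> y0 my; rewrite /toggle; case: ifPn => ys; last by rewrite mem_head.
have hy : y != y./2 by apply/eqP; lia.
rewrite !inE (negPf hy) /= -has_pred1 has_count count_rem ys /= eqxx.
by apply: negbTE; rewrite -leqNgt leq_subLR; apply: max_pivot_count.
Qed.

Lemma toggleK s y :
  0 < y -> max_pivot s y -> perm_eq (toggle y (toggle y s)) s.
Proof.
move=> y0 my; rewrite {1}/toggle mem_toggle // if_neg /toggle.
case: (boolP (y \in s)) => ys.
  by rewrite /= eqxx /= eqxx perm_sym perm_to_rem.
by rewrite /= eqxx perm_sym perm_rem2 // pivot_notin //; case: my.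
Qed.

Lemma count_toggle s y z : z != y -> z != y./2 -> pivot s y ->
  count_mem z (toggle y s) = count_mem z s.
Proof.
move=> zy zh py; rewrite /toggle; case: ifPn => ys.
  rewrite (permP (perm_to_rem ys) (pred1 z)) /=.
  by rewrite !(eq_sym _ z) (negPf zy) (negPf zh).
rewrite (permP (perm_rem2 (pivot_notin py ys)) (pred1 z)) /=.
by rewrite !(eq_sym _ z) (negPf zy) (negPf zh).
Qed.

Lemma toggle_max s y : 0 < y -> max_pivot s y -> max_pivot (toggle y s) y.
Proof.
move=> y0 my; have [py maxy] := my; have /andP[ey _] := py.
split.
  rewrite /pivot ey mem_toggle //=; case: (boolP (y \in s)) => //= ys.
  by rewrite /toggle ys /= eqxx !addnA.
move=> z /andP[ez pz]; rewrite leqNgt; apply/negP => lt_yz.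
have : ~~ pivot s z by apply/negP => /maxy; rewrite leqNgt lt_yz.
rewrite /pivot ez /= -has_pred1 has_count => np.
move: pz; rewrite -has_pred1 has_count.
rewrite (@count_toggle _ _ z) //; try by apply/eqP; lia.
(* For even [z > y] the count of [z] is unchanged, and that of [z./2] can change only if [z./2 = y].
   In that case the new sequence holds no [y] after a split and exactly one after a merge, too few
   for [z] to be a pivot. *)
have [hz|hz] := eqVneq z./2 y; last first.
  by rewrite count_toggle ?(negPf np) //; apply/eqP; lia.
rewrite hz; case/orP=> [c|]; first by rewrite c in np.
rewrite /toggle; case: ifPn => ys /=.
  have := max_pivot_count y0 my; rewrite count_rem ys /= eqxx.
  by have /negPf-> : y./2 != y by [apply/eqP; lia]; lia.
rewrite eqxx !count_rem.
by rewrite (count_memPn ys) !sub0n.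
Qed.

Lemma max_pivot_inj s y z : max_pivot s y -> max_pivot s z -> y = z.
Proof. by case=> py my [pz mz]; apply/eqP; rewrite eqn_leq mz ?my. Qed.

Lemma sumn_toggle s y : pivot s y -> sumn (toggle y s) = sumn s.
Proof.
move=> py; have /andP[/half_even ey _] := py.
rewrite /toggle; case: ifPn => ys.
  by rewrite (perm_sumn (perm_to_rem ys)) /= addnA -ey.
by rewrite (perm_sumn (perm_rem2 (pivot_notin py ys))) /= [RHS]addnA -ey.
Qed.

Lemma odd_size_toggle s y :
  pivot s y -> odd (size (toggle y s)) = ~~ odd (size s).
Proof.
move=> py; rewrite /toggle; case: ifPn => ys.
  by rewrite (perm_size (perm_to_rem ys)) /= !negbK.
by rewrite (perm_size (perm_rem2 (pivot_notin py ys))) /= !negbK.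
Qed.

(** Serves both positivity of the parts and [l]-regularity. *)
Lemma all_toggle (P : pred nat) s y : pivot s y -> P y = P y./2 ->
  all P (toggle y s) = all P s.
Proof.
move=> py Py; rewrite /toggle; case: ifPn => ys.
  by rewrite (perm_all _ (perm_to_rem ys)) /= Py andbA andbb.
by rewrite (perm_all _ (perm_rem2 (pivot_notin py ys))) /= Py [RHS]andbA andbb.
Qed.

(** * Existence of a largest pivot *)

Lemma odd_distinct_pivot s y : odd_distinct s -> ~~ pivot s y.
Proof.
case/andP=> us /allP os; apply/negP => /andP[ey /orP[/os|]].
  by rewrite (negPf ey).
by rewrite count_uniq_mem //; case: (_ \in _).
Qed.

Lemma exists_pivot s : ~~ odd_distinct s -> exists y, pivot s y.
Proof.
rewrite negb_and => /orP[nu|]; last first.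
  by case/allPn=> y ys ey; exists y; rewrite /pivot ey ys.
have /hasP[x xs x2] : has (fun x => 1 < count_mem x s) s.
  apply: contraNT nu => /hasPn le1; apply: count_mem_uniq => x.
  have [xs|/count_memPn //] := boolP (x \in s).
  have := le1 x xs; have : 0 < count_mem x s by rewrite -has_count has_pred1.
  by rewrite /=; lia.
by exists x.*2; rewrite /pivot odd_double doubleK x2 orbT.
Qed.

Lemma pivot_le_sumn s y : pivot s y -> y <= sumn s.
Proof.
move=> py; have /andP[/half_even ey _] := py.
have [ys|ys] := boolP (y \in s).
  by rewrite (perm_sumn (perm_to_rem ys)) leq_addr.
by rewrite (perm_sumn (perm_rem2 (pivot_notin py ys))) /= addnA -ey leq_addr.
Qed.

(** By [pivot_le_sumn] the range misses no pivot; the value is 0 if there is none. *)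
Definition top (s : seq nat) : nat := \max_(y < (sumn s).+1 | pivot s y) y.

Lemma topP s : ~~ odd_distinct s -> max_pivot s (top s).
Proof.
case/exists_pivot=> y py; have le_y : y < (sumn s).+1 by rewrite ltnS pivot_le_sumn.
split=> [|z pz].
  rewrite /top; have [|i pi ->] := @eq_bigmax_cond _ [pred i : 'I_(sumn s).+1 | pivot s i] val => //.
  by apply/card_gt0P; exists (Ordinal le_y).
have le_z : z < (sumn s).+1 by rewrite ltnS pivot_le_sumn.
exact: (@leq_bigmax_cond _ (fun i : 'I__ => pivot s i) val (Ordinal le_z)).
Qed.

(** * The involution on partitions *)

Lemma toggle_part n (p : intpart n) y :
  pivot p y -> is_part n (sort geq (toggle y p)).
Proof.
move=> py; have /and3P[_ pos /eqP sp] := partsP p.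
have st : perm_eq (sort geq (toggle y p)) (toggle y p) by rewrite perm_sort.
apply/and3P; split.
- by apply: sort_sorted => i j; rewrite /geq /= leq_total.
- rewrite (perm_all _ st) all_toggle //.
  have y0 := pivot_gt0 pos py; have /andP[/half_even ey _] := py.
  by apply/idP/idP; rewrite /ltn /=; lia.
- by rewrite (perm_sumn st) sumn_toggle // sp.
Qed.

(** The default [p] of [insubd] is never reached, by [toggle_part] at the pivot [top p]. *)
Definition flip n (p : intpart n) : intpart n :=
  if odd_distinct p then p else insubd p (sort geq (toggle (top p) p)).

Lemma perm_flip n (p : intpart n) :
  ~~ odd_distinct p -> perm_eq (flip p) (toggle (top p) p).
Proof.
move=> np; have [py _] := topP np; rewrite /flip (negPf np).
by rewrite -/(val _) val_insubd toggle_part // perm_sort.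
Qed.

Lemma top_gt0 n (p : intpart n) : ~~ odd_distinct p -> 0 < top p.
Proof.
move=> /topP[py _]; have /and3P[_ pos _] := partsP p; exact: pivot_gt0 pos py.
Qed.

Lemma flip_max_pivot n (p : intpart n) :
  ~~ odd_distinct p -> max_pivot (flip p) (top p).
Proof.
move=> np; have [py my] := toggle_max (top_gt0 np) (topP np).
by split=> [|z]; rewrite (perm_pivot (perm_flip np)) //; apply: my.
Qed.

Lemma odd_distinct_flip n (p : intpart n) :
  odd_distinct (flip p) = odd_distinct p.
Proof.
have [od|np] := boolP (odd_distinct p); first by rewrite /flip od.
by apply: contraTF (proj1 (flip_max_pivot np)); apply: odd_distinct_pivot.
Qed.

Lemma flipK n : involutive (@flip n).
Proof.
move=> p; have [od|np] := boolP (odd_distinct p); first by rewrite /flip !od.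
have nfp : ~~ odd_distinct (flip p) by rewrite odd_distinct_flip.
(* Sorted sequences that are permutations of each other coincide, so [toggleK] suffices once both
   moves use the same pivot. *)
apply/val_inj/(@sorted_eq _ geq) => /=.
- by move=> x y z /= yx zx; apply: leq_trans zx yx.
- by move=> x y; rewrite andbC -eqn_leq => /eqP.
- by case/and3P: (partsP (flip (flip p))).
- by case/and3P: (partsP p).
apply: perm_trans (perm_flip nfp) _.
rewrite (max_pivot_inj (topP nfp) (flip_max_pivot np)).
by apply: perm_trans (perm_toggle _ (perm_flip np)) (toggleK (top_gt0 np) (topP np)).
Qed.

Lemma regular_flip l n (p : intpart n) : odd l -> regular l (flip p) = regular l p.
Proof.
move=> ol; have [od|np] := boolP (odd_distinct p); first by rewrite /flip od.
have [py _] := topP np; have /andP[/half_even ey _] := py.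
rewrite /regular (perm_all _ (perm_flip np)) all_toggle //.
(* Since [l] is coprime to 2, it divides [y] exactly when it divides [y./2]. *)
by rewrite {1}ey addnn -mul2n Gauss_dvdr // coprimen2.
Qed.

Lemma odd_size_flip n (p : intpart n) :
  ~~ odd_distinct p -> odd (size (flip p)) = ~~ odd (size p).
Proof.
by move=> np; rewrite (perm_size (perm_flip np)) odd_size_toggle //; case: (topP np).
Qed.

Lemma odd_size_all_odd s : all odd s -> odd (size s) = odd (sumn s).
Proof. by elim: s => //= x s IHs /andP[ox /IHs->]; rewrite oddD ox. Qed.

(** * Signed sums over regular partitions *)

Import GRing.Theory.
Local Open Scope ring_scope.

Lemma signed_sum_not_odd_distinct l n : odd l ->
  \sum_(p : intpart n | regular l p && ~~ odd_distinct p) (-1) ^+ size p = 0 :> int.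
Proof.
move=> ol; set S := (X in X = 0).
(* Reindexing by [flip] changes every sign. *)
suff : S = - S by lia.
rewrite {1}/S (reindex_inj (inv_inj (@flipK n))) -sumrN.
apply: eq_big => p; first by rewrite regular_flip // odd_distinct_flip.
rewrite odd_distinct_flip => /andP[_ np].
by rewrite -signr_odd odd_size_flip // signrN signr_odd.
Qed.

Lemma card_set_sumz (T : finType) (P : pred T) : #|[set x | P x]|%:Z = \sum_(x | P x) 1.
Proof. by rewrite sumr_const cardsE natz. Qed.

Theorem theorem1p2 (l n : nat) (l_gt1 : (1 < l)%N) (l_odd : odd l)
    (n_gt0 : (0 < n)%N) :
  ((b_even l n)%:Z - (b_odd l n)%:Z = (-1) ^+ n * (c_odd_distinct l n)%:Z)%R.
Proof.
transitivity (\sum_(p : intpart n | regular l p) (-1) ^+ size p : int).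
  rewrite (bigID (fun p : intpart n => ~~ odd (size p))) /=.
  rewrite /b_even /b_odd !card_set_sumz -sumrN; congr (_ + _).
    by apply: eq_bigr => p /andP[_ /negPf ep]; rewrite -signr_odd ep.
  apply: eq_big => p; first by rewrite negbK.
  by case/andP=> _ op; rewrite -signr_odd op.
(* Only the fixed points of [flip] contribute; their parts are odd, so each has sign [(-1) ^+ n]. *)
rewrite (bigID (fun p : intpart n => odd_distinct p)) /=.
rewrite signed_sum_not_odd_distinct // addr0.
rewrite /c_odd_distinct card_set_sumz mulr_sumr.
apply: eq_big => p; first by rewrite andbC andbA.
case/and3P=> _ _ /odd_size_all_odd op.
have /and3P[_ _ /eqP sp] := partsP p.
by rewrite mulr1 -signr_odd op sp signr_odd.
Qed.
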